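(* All generic monomial ideals in $R=\mathbf{k}[x_1,\dots,x_n]$ are Mayer-Vietoris ideals of type $B1$.
   Context: $\mathbf{k}$ is a field of characteristic $0$, $R=\mathbf{k}[x_1,\dots,x_n]$. Monomial ideals are nonzero. Generic: a monomial ideal $I$ with minimal generators $m_1,\dots,m_r$ is generic if whenever two distinct minimal generators $m_i$ and $m_j$ have the same positive degree in some variable, there is a third minimal generator $m_k$ which strictly divides $\mathrm{lcm}(m_i,m_j)$ (a monomial $m$ strictly divides $m'$ if $m$ divides $m'/x_l$ for every variable $x_l$ dividing $m'$). Mayer-Vietoris trees: a Mayer-Vietoris tree $MVT(I)$ of $I$ is a rooted binary tree whose nodes are (labelled by) monomial ideals, with root $I$. Whenever a node $J$ has minimal monomial generating set $\{m_1,\dots,m_s\}$ with $s\geq 2$, one minimal generator (the pivot monomial) is chosen, the choice being arbitrary at each node; numbering so that the pivot is $m_s$, the node $J$ has exactly two children: the left child $\tilde J=\langle m_1,\dots,m_{s-1}\rangle\cap\langle m_s\rangle=\langle \mathrm{lcm}(m_1,m_s),\dots,\mathrm{lcm}(m_{s-1},m_s)\rangle$ and the right child $J'=\langle m_1,\dots,m_{s-1}\rangle$. Nodes with a single minimal generator are leaves. Positions: the root has position $1$; left and right children of the node in position $p$ have positions $2p$ and $2p+1$. Dimensions: the root has dimension $0$; left and right children of a node of dimension $d$ have dimensions $d+1$ and $d$. A node is relevant if its position is $1$ or even. Type $B1$: for a tree $MVT(I)$ let $\overline{\beta}_{i,a}(I)=1$ if $x^a$ is a minimal generator of a relevant node of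 dimension $i$ and is not a minimal generator of any other relevant node, and $\overline{\beta}_{i,a}(I)=0$ otherwise; let $\beta_{i,a}(I)=\dim_{\mathbf{k}}\mathrm{Tor}^R_{i,a}(I,\mathbf{k})$. $I$ is a Mayer-Vietoris ideal of type $B1$ if there is a Mayer-Vietoris tree of $I$ with $\overline{\beta}_{i,a}(I)=\beta_{i,a}(I)$ for all $i\in\mathbb{N}$, $a\in\mathbb{N}^n$. *)

(* Defs.v *)
From mathcomp Require Export all_boot all_order all_algebra.
From mathcomp Require Export mpoly.
From Stdlib Require Import ClassicalEpsilon.

Set Implicit Arguments.
Unset Strict Implicit.
Unset Printing Implicit Defensive.

Import GRing.Theory.
Local Open Scope ring_scope.

Section MayerVietoris.

Variables (k : fieldType) (n : nat).

Local Notation R := {mpoly k[n]}.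
Local Notation mon := 'X_{1..n}.

(* Exponent vectors a : 'X_{1..n} stand for the monomials x^a = 'X_[a];
   (a <= b)%MM is divisibility of x^b by x^a. *)

Definition ideal := R -> Prop.

Definition ideal_gen (A : mon -> Prop) : ideal := fun p =>
  exists s : seq (R * mon),
    (forall u, u \in s -> A u.2) /\ p = \sum_(u <- s) u.1 * 'X_[u.2].

Definition ideal_cap (I J : ideal) : ideal := fun p => I p /\ J p.

(* Monomial ideals are nonzero by convention. *)
Definition monomial_ideal (I : ideal) : Prop :=
  (exists A : mon -> Prop, forall p, I p <-> ideal_gen A p)
  /\ (exists p, I p /\ p <> 0).

Definition mingen (I : ideal) (m : mon) : Prop :=
  I 'X_[m] /\ forall m' : mon, I 'X_[m'] -> (m' <= m)%MM -> m' = m.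

Definition strictly_divides (m m' : mon) : Prop :=
  forall l : 'I_n, (0 < m' l)%N -> (m <= m' - U_(l))%MM.

Definition generic (I : ideal) : Prop :=
  forall mi mj : mon, mingen I mi -> mingen I mj -> mi <> mj ->
  (exists l : 'I_n, (0 < mi l)%N /\ mi l = mj l) ->
  exists mk : mon, [/\ mingen I mk, mk <> mi, mk <> mj
                     & strictly_divides mk (mlcm mi mj)].

Definition mv_right (J : ideal) (m : mon) : ideal :=
  ideal_gen (fun m' => mingen J m' /\ m' <> m).

Definition mv_left (J : ideal) (m : mon) : ideal :=
  ideal_cap (mv_right J m) (ideal_gen (fun m' => m' = m)).

(* A tree only records the pivots; the ideals labelling its nodes are
   determined by these and by the root ideal, see [mv_node]. *)
Inductive mvtree : Type :=
| MVLeaf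
| MVNode (pivot : mon) (left right : mvtree).

Fixpoint is_mvtree (J : ideal) (t : mvtree) : Prop :=
  match t with
  | MVLeaf => exists m, forall m', mingen J m' <-> m' = m
  | MVNode m l r =>
      [/\ mingen J m, exists m', mingen J m' /\ m' <> m,
          is_mvtree (mv_left J m) l & is_mvtree (mv_right J m) r]
  end.

(* [mv_node I t p d J s]: the tree t with root I has, in position p and with
   dimension d, a node labelled J; s is the subtree of t rooted there. *)
Inductive mv_node (I : ideal) (t : mvtree) :
    nat -> nat -> ideal -> mvtree -> Prop :=
| mv_node_root : mv_node I t 1 0 I t
| mv_node_left p d J m l r : mv_node I t p d J (MVNode m l r) ->
    mv_node I t (2 * p) d.+1 (mv_left J m) l
| mv_node_right p d J m l r : mv_node I t p d J (MVNode m l r) ->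
    mv_node I t (2 * p + 1) d (mv_right J m) r.

Definition relevant_node (I : ideal) (t : mvtree) (p d : nat) (J : ideal) :
    Prop :=
  (p = 1%N \/ ~~ odd p) /\ exists s, mv_node I t p d J s.

(* Distinct nodes may carry equal ideals, so nodes are compared by position. *)
Definition mv_unrepeated (I : ideal) (t : mvtree) (i : nat) (a : mon) : Prop :=
  exists p J, [/\ relevant_node I t p i J, mingen J a
    & forall p' d' J', relevant_node I t p' d' J' -> mingen J' a -> p' = p].

Definition betabar (I : ideal) (t : mvtree) (i : nat) (a : mon) : nat :=
  if excluded_middle_informative (mv_unrepeated I t i a) then 1%N else 0%N.

(* A multigraded resolution of I by finitely generated free modules
     ... -> F_2 -> F_1 -> F_0 -> I -> 0,
   with F_i = R^(fr_rk i). Elements of F_i are row vectors and matrices act on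
   the right. The j-th basis vector of F_i has multidegree [fr_deg j]. *)
Record free_resolution (I : ideal) := FreeResolution {
  fr_rk : nat -> nat;
  fr_deg : forall i, 'I_(fr_rk i) -> mon;
  fr_diff : forall i, 'M[R]_(fr_rk i.+1, fr_rk i);
  fr_aug : 'cV[R]_(fr_rk 0);
  fr_diff_homog : forall i u v m,
    m \in msupp (fr_diff i u v) -> (m + fr_deg v)%MM = fr_deg u;
  fr_aug_homog : forall u m, m \in msupp (fr_aug u 0) -> m = fr_deg u;
  fr_aug_im : forall p, I p <-> exists w : 'rV[R]_(fr_rk 0),
    p = (w *m fr_aug) 0 0;
  fr_aug_exact : forall w : 'rV[R]_(fr_rk 0),
    w *m fr_aug = 0 <-> exists w', w = w' *m fr_diff 0;
  fr_exact : forall i (w : 'rV[R]_(fr_rk i.+1)),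
    w *m fr_diff i = 0 <-> exists w', w = w' *m fr_diff i.+1
}.

(* The differential of F (x)_R k: since k = R / (x_1, ..., x_n), every entry is
   replaced by its constant term. *)
Definition fr_diffk (I : ideal) (F : free_resolution I) (i : nat) :
    'M[k]_(fr_rk F i.+1, fr_rk F i) :=
  map_mx (fun p : R => p@_0%MM) (fr_diff F i).

(* Row space: the multidegree a part of F_i (x)_R k. *)
Definition fr_part (I : ideal) (F : free_resolution I) (i : nat) (a : mon) :
    'M[k]_(fr_rk F i) :=
  diag_mx (\row_j (fr_deg (f := F) j == a)%:R).

(* Row space: the kernel of the differential leaving F_i (x)_R k, which is the
   zero map for i = 0. *)
Definition fr_cycles (I : ideal) (F : free_resolution I) (i : nat) :
    'M[k]_(fr_rk F i) :=
  match i with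
  | 0 => 1%:M
  | j.+1 => kermx (fr_diffk F j)
  end.

(* dim_k H_i(F (x)_R k)_a = dim_k (cycles)_a - dim_k (boundaries)_a. *)
Definition fr_tor_dim (I : ideal) (F : free_resolution I) (i : nat) (a : mon) :
    nat :=
  (\rank (fr_cycles F i :&: fr_part F i a)%MS
   - \rank (fr_diffk F i :&: fr_part F i a)%MS)%N.

(* dim_k Tor^R_{i,a}(I, k) = b. Tor is the homology of F (x)_R k for a
   multigraded free resolution F of I; it does not depend on F. *)
Definition is_betti (I : ideal) (i : nat) (a : mon) (b : nat) : Prop :=
  exists F : free_resolution I, fr_tor_dim F i a = b.

Definition mv_type_B1 (I : ideal) : Prop :=
  exists t : mvtree, is_mvtree I t /\
    forall (i : nat) (a : mon), is_betti I i a (betabar I t i a).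

End MayerVietoris.

(* Main.v *)
Require Import Defs.
From mathcomp Require Import zify.
Import GRing.Theory.
Local Open Scope ring_scope.

(** Label each nonempty set of minimal generators (a face) by its least common
    multiple. The Taylor resolution has the faces as its basis, so the Betti
    numbers in multidegree a are the homology of the complex of faces labelled
    a. If a generator m strictly divides a and a is not the monomial 1, then adding
    or removing m preserves the label a, hence this complex is a cone and its homology vanishes
    ([fr_tor_dim_strict]). If only one face has the label a, it gives a single
    Betti number 1 in homological degree its size minus 1
    ([fr_tor_dim_unique]). Genericity says that nothing else happens: a label
    shared by two faces is strictly divided by a generator
    ([generic_lcm_repeated]).

    On the side of the trees, consider the tree in which the pivot is always the
    first generator. Gathering the generators of the relevant nodes amounts to
    taking one generator per node, so these multidegrees satisfy a recursion:
    those of (x, s) are x, those of s, and those of the minimal elements among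
    the lcm(x, y), y in s, in one dimension higher. The labels of faces satisfy
    the same recursion without the passage to minimal elements. Two
    consequences: in every dimension a multidegree occurs in the tree at most as
    often as it labels a face ([count_mv_degs]), and the signed counts agree,
    since both are numerators of the Hilbert series of the ideal
    ([euler_char_mv]).

    A label a of a unique face therefore occurs at most once in the tree, and at
    least once because its signed count is a sign; the dimension is the right
    one. A label of several faces is strictly divided by a generator, its faces
    cancel in pairs, its signed count is zero, and so it does not occur exactly
    once in the tree ([euler_char_taylor_strict]). *)

Set Implicit Arguments.
Unset Strict Implicit.
Unset Printing Implicit Defensive.

(** * Minimal monomials and Dickson's lemma *)

Section Monomials.

Variable n : nat.
Implicit Types (m x y z a b c : 'X_{1..n}) (s : seq 'X_{1..n}).

Definition divisor_in s c : bool := has (fun m => (m <= c)%MM) s.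

Lemma lepm_anti m1 m2 : (m1 <= m2)%MM -> (m2 <= m1)%MM -> m1 = m2.
Proof.
move=> /mnm_lepP le12 /mnm_lepP le21; apply/mnmP => i.
by apply/eqP; rewrite eqn_leq le12 le21.
Qed.

Lemma lepm_mdeg_lt m1 m2 :
  (m1 <= m2)%MM -> m1 != m2 -> (mdeg m1 < mdeg m2)%N.
Proof.
move=> le12 ne; rewrite -(submK le12) mdegD -[X in (X < _)%N]add0n ltn_add2r.
rewrite lt0n mdeg_eq0; apply: contra ne => /eqP e.
by rewrite -(submK le12) e add0m.
Qed.

Lemma mlcm_id m1 m2 : (m1 <= m2)%MM -> mlcm m1 m2 = m2.
Proof.
by move=> /mnm_lepP h; apply/mnmP => i; rewrite /mlcm mnmE; apply/maxn_idPr.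
Qed.

Definition minimals s : seq 'X_{1..n} :=
  [seq y <- undup s | all (fun z => (z <= y)%MM ==> (z == y)) s].

Definition antichain s : Prop :=
  forall y z, y \in s -> z \in s -> (y <= z)%MM -> y = z.

Lemma minimals_uniq s : uniq (minimals s).
Proof. by rewrite filter_uniq ?undup_uniq. Qed.

Lemma minimals_subseq s : subseq (minimals s) s.
Proof. exact: subseq_trans (filter_subseq _ _) (undup_subseq _). Qed.

Lemma size_minimals s : (size (minimals s) <= size s)%N.
Proof. exact: size_subseq (minimals_subseq s). Qed.

Lemma minimalsP s y :
  reflect (y \in s /\ forall z, z \in s -> (z <= y)%MM -> z = y)
          (y \in minimals s).
Proof.
rewrite mem_filter mem_undup andbC; apply: (iffP andP) => -[ys h]; split=> //.
  by move=> z zs zy; move/allP: h => /(_ z zs); rewrite zy => /eqP.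
by apply/allP => z zs; apply/implyP => zy; apply/eqP; apply: h.
Qed.

Lemma minimals_antichain s : antichain (minimals s).
Proof. by move=> y z /minimalsP [ys _] /minimalsP [_ zm] /(zm _ ys). Qed.

Lemma minimals_id s : antichain s -> minimals s =i s.
Proof.
move=> sa y; apply/minimalsP/idP => [[]//|ys]; split=> // z zs zy.
exact: sa zy.
Qed.

Lemma minimals_below s y :
  y \in s -> exists2 z, z \in minimals s & (z <= y)%MM.
Proof.
have [d] := ubnP (mdeg y); elim: d y => // d IH y; rewrite ltnS => yd ys.
case: (boolP (y \in minimals s)) => [ym|]; first by exists y; rewrite ?lepm_refl.
rewrite mem_filter mem_undup ys andbT => /allPn [z zs].
rewrite negb_imply => /andP [zy ne].
have [|w wm wz] := IH z _ zs.
  exact: leq_trans (lepm_mdeg_lt zy ne) yd.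
by exists w => //; apply: lepm_trans zy.
Qed.

Lemma divisor_in_minimals s c : divisor_in (minimals s) c = divisor_in s c.
Proof.
apply/hasP/hasP => -[y].
  by move=> /minimalsP [ys _] yc; exists y.
move=> /minimals_below [z zm zy] yc; exists z => //; exact: lepm_trans yc.
Qed.

Lemma divisor_in_lcm x s c :
  divisor_in [seq mlcm x y | y <- s] c = (x <= c)%MM && divisor_in s c.
Proof.
rewrite /divisor_in has_map (eq_has (a2 := fun y => (x <= c)%MM && (y <= c)%MM)).
  by elim: s => [|y s IH] /=; rewrite ?andbF // IH andb_orr.
by move=> y /=; rewrite lem_mlcm.
Qed.

(** The induction is on the number of coordinates that are compared: once the
    first j coordinates are dealt with by a finite list, only the members
    whose j-th coordinate is one of the finitely many values below the maximum
    over that list remain, and on each of these slices that coordinate is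
    constant. *)
Lemma dickson_upto (A : 'X_{1..n} -> Prop) (j : nat) :
  exists s, (forall m, m \in s -> A m) /\
    forall a, A a -> exists2 b, b \in s &
      forall l : 'I_n, (l < j)%N -> (b l <= a l)%N.
Proof.
elim: j A => [|j IH] A.
  case: (ClassicalEpsilon.excluded_middle_informative (exists a, A a)).
    move=> [a Aa]; exists [:: a]; split=> [m|b _]; first by rewrite inE => /eqP->.
    by exists a; rewrite ?inE.
  by move=> nA; exists [::]; split=> // a Aa; case: nA; exists a.
have [s [sA sP]] := IH A.
case: (ltnP j n) => [jn|nj]; last first.
  exists s; split=> // a /sP [b bs bP]; exists b => // l lj.
  exact/bP/(leq_trans (ltn_ord l)).
pose o := Ordinal jn.
have slices N : exists t : seq 'X_{1..n}, (forall m, m \in t -> A m) /\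
    forall a, A a -> (a o < N)%N -> exists2 b, b \in t &
      forall l : 'I_n, (l < j.+1)%N -> (b l <= a l)%N.
  elim: N => [|N [t [tA tP]]]; first by exists [::]; split.
  have [t' [t'A t'P]] := IH (fun a => A a /\ a o = N).
  exists (t ++ t'); split=> [m|a Aa].
    by rewrite mem_cat => /orP [/tA|/t'A []].
  rewrite ltnS leq_eqVlt => /orP [/eqP aN|aN]; last first.
    by have [b bt bP] := tP a Aa aN; exists b; rewrite ?mem_cat ?bt.
  have [b bt bP] := t'P a (conj Aa aN).
  exists b; first by rewrite mem_cat bt orbT.
  move=> l; rewrite ltnS leq_eqVlt => /orP [/eqP lj|]; last exact: bP.
  have -> : l = o by apply/val_inj.
  by have [_ ->] := t'A b bt; rewrite aN.
have [t [tA tP]] := slices (\max_(b <- s) b o)%N.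
exists (s ++ t); split=> [m|a Aa]; first by rewrite mem_cat => /orP [/sA|/tA].
case: (ltnP (a o) (\max_(b <- s) b o)%N) => [lt|ge].
  by have [b bt bP] := tP a Aa lt; exists b; rewrite ?mem_cat ?bt ?orbT.
have [b bs bP] := sP a Aa; exists b; first by rewrite mem_cat bs.
move=> l; rewrite ltnS leq_eqVlt => /orP [/eqP lj|]; last exact: bP.
have -> : l = o by apply/val_inj.
by apply: leq_trans ge; rewrite (big_rem b bs) leq_maxl.
Qed.

Lemma dickson (A : 'X_{1..n} -> Prop) :
  exists s, (forall m, m \in s -> A m) /\
    forall a, A a -> exists2 b, b \in s & (b <= a)%MM.
Proof.
have [s [sA sP]] := dickson_upto A n; exists s; split=> // a /sP [b bs bP].
by exists b => //; apply/mnm_lepP => l; apply: bP.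
Qed.

End Monomials.

(** * Monomial ideals and their minimal generators *)

Section MonomialIdeals.

Variables (k : fieldType) (n : nat).
Implicit Types (J : ideal k n) (p : {mpoly k[n]}) (s : seq 'X_{1..n}).

Lemma ideal_genP (A : 'X_{1..n} -> Prop) p :
  ideal_gen A p <-> forall u, u \in msupp p -> exists2 a, A a & (a <= u)%MM.
Proof.
split=> [[s [sA ->]] u|].
  elim: s sA => [|[q a] s IH] sA; first by rewrite big_nil msupp0.
  rewrite big_cons => /msuppD_le; rewrite mem_cat => /orP [|us]; last first.
    by apply: IH us => v vs; apply: sA; rewrite inE vs orbT.
  rewrite (perm_mem (msuppMX _ _)) => /mapP [v _ ->]; exists a => /=.
    by apply: (sA (q, a)); rewrite inE eqxx.
  exact: lem_addr.
move=> pP; rewrite (mpolyE p); elim: (msupp p) pP => [|u t IH] tP.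
  by exists [::]; rewrite !big_nil.
rewrite big_cons; have [v vt|s [sA ->]] := IH; first by apply: tP; rewrite inE vt orbT.
have [|a Aa au] := tP u; first by rewrite inE eqxx.
exists ((p@_u *: 'X_[u - a], a) :: s); split=> [v|].
  by rewrite inE => /orP [/eqP->|/sA].
by rewrite big_cons /= -scalerAl -mpolyXD submK.
Qed.

Lemma ideal_gen_X (A : 'X_{1..n} -> Prop) (b : 'X_{1..n}) :
  ideal_gen A ('X_[b] : {mpoly k[n]}) <-> exists2 a, A a & (a <= b)%MM.
Proof.
rewrite ideal_genP; split=> [h|h u]; last by rewrite msuppX inE => /eqP->.
by apply: h; rewrite msuppX inE.
Qed.

Definition mingens J s : Prop := forall m, mingen J m <-> m \in s.

Lemma mingens_minimals J s :
  (forall b, J 'X_[b] <-> divisor_in s b) -> mingens J (minimals s).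
Proof.
move=> JP m; split=> [[/JP Jm mmin]|ms].
  rewrite -divisor_in_minimals in Jm; case/hasP: Jm => z zs zm.
  rewrite -(mmin z) //; apply/JP; rewrite -divisor_in_minimals.
  by apply/hasP; exists z; rewrite ?lepm_refl.
split=> [|m' /JP].
  by apply/JP; rewrite -divisor_in_minimals; apply/hasP; exists m; rewrite ?lepm_refl.
rewrite -divisor_in_minimals; case/hasP => z zs zm' m'm.
have e := minimals_antichain zs ms (lepm_trans zm' m'm).
by apply: lepm_anti m'm _; rewrite -e.
Qed.

Lemma mv_right_X J x s b : mingens J (x :: s) -> uniq (x :: s) ->
  mv_right J x 'X_[b] <-> divisor_in s b.
Proof.
move=> Js /andP [xs _]; rewrite /mv_right ideal_gen_X; split.
  move=> [a [/Js]]; rewrite inE => /orP [/eqP //|as_] _ ab.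
  by apply/hasP; exists a.
case/hasP => a as_ ab; exists a => //; split.
  by apply/Js; rewrite inE as_ orbT.
by move=> e; rewrite -e as_ in xs.
Qed.

(** A monomial lies in the intersection exactly when it is a multiple of x and
    of some y in s, that is, of lcm(x, y). *)
Lemma mv_left_X J x s b : mingens J (x :: s) -> uniq (x :: s) ->
  mv_left J x 'X_[b] <-> divisor_in [seq mlcm x y | y <- s] b.
Proof.
move=> Js us; rewrite divisor_in_lcm /mv_left /ideal_cap (mv_right_X _ Js us).
rewrite ideal_gen_X; split=> [[-> [a -> ->]] //|/andP [xb ->]].
by split=> //; exists x.
Qed.

Lemma mingens_right J x s :
  mingens J (x :: s) -> uniq (x :: s) -> antichain s ->
  mingens (mv_right J x) s.
Proof.
move=> Js us sa m; rewrite -(minimals_id sa).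
by apply: mingens_minimals => b; apply: mv_right_X.
Qed.

Lemma mingens_left J x s : mingens J (x :: s) -> uniq (x :: s) ->
  mingens (mv_left J x) (minimals [seq mlcm x y | y <- s]).
Proof. by move=> Js us; apply: mingens_minimals => b; apply: mv_left_X. Qed.

(** The minimal members of a finite generating set, which exists by Dickson's
    lemma, are the minimal generators, so these are finite in number and
    generate the ideal. *)
Lemma monomial_ideal_mingens J : monomial_ideal J ->
  exists s, [/\ uniq s, antichain s, s <> [::], mingens J s &
    forall p, J p <-> forall u, u \in msupp p -> divisor_in s u].
Proof.
move=> [[A JA] [p0 [Jp0 p0n]]]; have [t [tA tP]] := dickson A.
have JP p : J p <-> forall u, u \in msupp p -> divisor_in (minimals t) u.
  rewrite JA ideal_genP; split=> h u /h.
    move=> [a /tP [b bt ba] au]; rewrite divisor_in_minimals.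
    by apply/hasP; exists b => //; apply: lepm_trans au.
  by rewrite divisor_in_minimals => /hasP [a /tA Aa au]; exists a.
exists (minimals t); split=> //.
- exact: minimals_uniq.
- exact: minimals_antichain.
- move=> t0; apply: p0n; apply/eqP; rewrite -msupp_eq0.
  case E : (msupp p0) => [|u v] //.
  by move/JP/(_ u): Jp0; rewrite t0 E inE eqxx => /(_ isT).
apply: mingens_minimals => b; rewrite JP -divisor_in_minimals; split=> h.
  by apply: h; rewrite msuppX inE.
by move=> u; rewrite msuppX inE => /eqP->.
Qed.

End MonomialIdeals.

(** * Multigraded Euler characteristics *)

Section EulerCharacteristics.

Variable n : nat.
Implicit Types (x y a b c : 'X_{1..n}) (s : seq 'X_{1..n}).
Implicit Types (u v : seq (nat * 'X_{1..n})).

Definition shift_deg (e : nat * 'X_{1..n}) := (e.1.+1, e.2).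

Definition euler_char u (P : pred 'X_{1..n}) : int :=
  \sum_(e <- u | P e.2) (-1) ^+ e.1.

(** The sum over the divisors of c is the coefficient of x^c in the quotient of
    the signed sum of the monomials in u by the product of the 1 - x_l, which
    is the Hilbert series of a module resolved by free modules with these
    multidegrees. *)
Definition same_hilbert u v : Prop :=
  forall c, euler_char u (fun a => (a <= c)%MM) =
            euler_char v (fun a => (a <= c)%MM).

Lemma euler_char_cat u v P :
  euler_char (u ++ v) P = euler_char u P + euler_char v P.
Proof. exact: big_cat. Qed.

Lemma euler_char_cons e u P :
  euler_char (e :: u) P = (if P e.2 then (-1) ^+ e.1 else 0) + euler_char u P.
Proof. by rewrite /euler_char big_cons; case: ifP; rewrite ?add0r. Qed.

Lemma euler_char_shift u P :
  euler_char [seq shift_deg e | e <- u] P = - euler_char u P.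
Proof.
rewrite /euler_char big_map -sumrN; apply: eq_bigr => e _.
by rewrite exprS mulN1r.
Qed.

(** The Hilbert series determines its numerator: the coefficient at a is the
    value at a minus the coefficients at the proper divisors of a. *)
Lemma same_hilbert_euler_char u v a :
  same_hilbert u v -> euler_char u (pred1 a) = euler_char v (pred1 a).
Proof.
move=> uv; have [d] := ubnP (mdeg a); elim: d a => // d IH a; rewrite ltnS => ad.
pose below w := euler_char w (fun b => (b <= a)%MM && (b != a)).
have split_a w : euler_char w (fun b => (b <= a)%MM) =
                 euler_char w (pred1 a) + below w.
  rewrite /euler_char (bigID (fun e => e.2 == a)) /=; congr (_ + _).
  by apply: eq_bigl => e; case: eqP => [->|]; rewrite ?andbF ?lepm_refl.
pose bs := [seq b <- undup [seq e.2 | e <- u ++ v] | (b <= a)%MM & b != a].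
have belowE w : {subset w <= u ++ v} ->
    below w = \sum_(b <- bs) euler_char w (pred1 b).
  move=> wuv.
  transitivity (\sum_(e <- w) \sum_(b <- bs | e.2 == b) (-1) ^+ e.1 : int).
    rewrite /below /euler_char big_mkcond /=; apply: eq_big_seq => e ew.
    rewrite big_filter_cond /=.
    have eU : e.2 \in undup [seq e'.2 | e' <- u ++ v].
      by rewrite mem_undup map_f ?wuv.
    rewrite big_mkcond (bigD1_seq e.2) ?undup_uniq //= eqxx andbT.
    by rewrite big1 ?addr0 // => b /negbTE; rewrite eq_sym => ->; rewrite andbF.
  by rewrite (exchange_big_dep xpredT).
have bE : below u = below v.
  rewrite !belowE => [|e ev|e eu]; try by rewrite mem_cat ?ev ?eu ?orbT.
  apply: eq_big_seq => b; rewrite mem_filter => /andP [/andP [ba ne] _].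
  exact/IH/(leq_trans (lepm_mdeg_lt ba ne)).
by move: (uv a); rewrite !split_a bE => /addIr.
Qed.

(** The multidegrees of the basis of the Taylor resolution of the ideal
    generated by s: one entry for each nonempty subsequence, carrying its least
    common multiple and its homological degree. *)
Fixpoint taylor_degs s : seq (nat * 'X_{1..n}) :=
  if s is x :: s' then
    (0%N, x) :: taylor_degs s' ++
      [seq shift_deg (e.1, mlcm x e.2) | e <- taylor_degs s']
  else [::].

Lemma mlcm_lcm x y z : mlcm (mlcm x y) (mlcm x z) = mlcm x (mlcm y z).
Proof.
by apply/mnmP => i; rewrite /mlcm !mnmE maxnACA maxnn.
Qed.

Lemma taylor_degs_lcm x s :
  taylor_degs [seq mlcm x y | y <- s] =
  [seq (e.1, mlcm x e.2) | e <- taylor_degs s].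
Proof.
elim: s => //= y s ->; congr (_ :: _); rewrite map_cat -!map_comp.
by congr (_ ++ _); apply: eq_map => -[d a] /=; rewrite /shift_deg /= mlcm_lcm.
Qed.

Lemma taylor_degs_cons x s :
  taylor_degs (x :: s) = (0%N, x) :: taylor_degs s ++
    [seq shift_deg e | e <- taylor_degs [seq mlcm x y | y <- s]].
Proof. by rewrite taylor_degs_lcm -map_comp. Qed.

Lemma count_taylor_degs_subseq (P : pred (nat * 'X_{1..n})) s1 s2 :
  subseq s1 s2 -> (count P (taylor_degs s1) <= count P (taylor_degs s2))%N.
Proof.
elim: s2 s1 P => [|x s2 IH] [|y s1] P //=; case: eqP => [->|_] sub.
  by rewrite !count_cat !count_map leq_add2l leq_add // IH.
apply: leq_trans (IH _ P sub) _.
by rewrite count_cat addnCA leq_addr.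
Qed.

(** A multiple of x or of a member of s is counted once for x and once for s,
    and the multiples of both, which are the multiples of the lcm(x, y), are
    subtracted. The Taylor degrees and the Mayer-Vietoris degrees obey this
    same recursion. *)
Lemma euler_char_inclusion_exclusion x s u v c :
  euler_char u (fun a => (a <= c)%MM) = (divisor_in s c)%:R ->
  euler_char v (fun a => (a <= c)%MM) =
    (divisor_in [seq mlcm x y | y <- s] c)%:R ->
  euler_char ((0%N, x) :: u ++ [seq shift_deg e | e <- v])
    (fun a => (a <= c)%MM) = (divisor_in (x :: s) c)%:R.
Proof.
move=> uE vE; rewrite euler_char_cons euler_char_cat euler_char_shift uE vE /=.
by rewrite divisor_in_lcm; case: (_ <= _)%MM; case: divisor_in.
Qed.

Lemma euler_char_taylor_below s c :
  euler_char (taylor_degs s) (fun a => (a <= c)%MM) = (divisor_in s c)%:R.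
Proof.
have [d] := ubnP (size s); elim: d s => // d IH [|x s]; rewrite ltnS => sd.
  by rewrite /euler_char big_nil.
rewrite taylor_degs_cons; apply: euler_char_inclusion_exclusion; apply: IH => //.
by rewrite size_map.
Qed.

Lemma strictly_divides_lt (m a : 'X_{1..n}) l :
  strictly_divides m a -> (0 < a l)%N -> (m l < a l)%N.
Proof.
move=> ma al; move/mnm_lepP: (ma l al) => /(_ l).
by rewrite mnmBE mnm1E eqxx leq_subRL // add1n.
Qed.

Lemma strictly_divides_lepm (m a : 'X_{1..n}) :
  a != 0%MM -> strictly_divides m a -> (m <= a)%MM.
Proof.
move=> a0 ma; case: (pickP (fun l => (0 < a l)%N)) => [l al|h].
  by apply: lepm_trans (ma l al) _; apply: lem_subr.
case/eqP: a0; apply/mnmP => l; rewrite mnm0E.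
by apply/eqP; rewrite -leqn0 leqNgt h.
Qed.

Lemma strictly_divides_lcm (m a b : 'X_{1..n}) :
  a != 0%MM -> strictly_divides m a -> (mlcm m b == a) = (b == a).
Proof.
move=> a0 ma; apply/eqP/eqP => [e|->].
  apply/mnmP => l; have := strictly_divides_lt (l := l) ma.
  by rewrite -e /mlcm !mnmE; lia.
exact/mlcm_id/strictly_divides_lepm.
Qed.

Lemma strictly_divides_trans (m b a : 'X_{1..n}) :
  b != 0%MM -> strictly_divides m b -> (b <= a)%MM -> strictly_divides m a.
Proof.
move=> b0 mb ba l al; have mb' := strictly_divides_lepm b0 mb.
have [bl|bl] := posnP (b l); last first.
  apply: lepm_trans (mb l bl) _; apply/mnm_lepP => l'.
  by rewrite !mnmBE leq_sub2r //; apply/mnm_lepP.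
apply/mnm_lepP => l'; rewrite mnmBE mnm1E; have := mnm_lepP mb' l'.
case: eqP => [<-|_]; first by rewrite bl leqn0 => /eqP ->.
by rewrite subn0 => /leq_trans; apply; apply/mnm_lepP.
Qed.

(** If m avoids every power of a variable that a attains, then adding or
    removing m does not change whether a subset has least common multiple a, so
    these subsets cancel in pairs; m may be put first because the Euler
    characteristic depends only on the ideal. *)
Lemma euler_char_taylor_strict s m a :
  m \in s -> a != 0%MM -> strictly_divides m a ->
  euler_char (taylor_degs s) (pred1 a) = 0.
Proof.
move=> ms a0 ma.
rewrite (@same_hilbert_euler_char _ (taylor_degs (m :: rem m s))); last first.
  move=> c; rewrite !euler_char_taylor_below; congr (nat_of_bool _)%:R.
  exact: (perm_has _ (perm_to_rem ms)).
rewrite taylor_degs_cons taylor_degs_lcm euler_char_cons euler_char_cat.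
rewrite euler_char_shift /=; case: eqP => [e|_].
  case/eqP: a0; apply/mnmP => l; rewrite mnm0E.
  have := @strictly_divides_lt m a l ma; rewrite e.
  by lia.
rewrite add0r; apply/eqP; rewrite subr_eq0; apply/eqP.
rewrite /euler_char big_map; apply: eq_bigl => -[d b] /=.
by rewrite strictly_divides_lcm.
Qed.

Lemma euler_char_count0 u a :
  count (fun e => e.2 == a) u = 0%N -> euler_char u (pred1 a) = 0.
Proof.
move/eqP; rewrite -leqn0 leqNgt -has_count => /hasPn h.
by rewrite /euler_char big_seq_cond big1 // => e /andP [/h /negbTE /= ->].
Qed.

Lemma euler_char_count1 u a :
  count (fun e => e.2 == a) u = 1%N -> euler_char u (pred1 a) != 0.
Proof.
rewrite -size_filter /euler_char -big_filter.
by case: (filter _ _) => [|e []] //= _; rewrite big_seq1 signr_eq0.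
Qed.

End EulerCharacteristics.

(** * Nodes of a Mayer-Vietoris tree as paths from the root *)

Section TreePaths.

Variables (k : fieldType) (n : nat).
Implicit Types (J K : ideal k n) (t : mvtree n) (w : seq bool).

(** Binary digits after a leading 1: left appends 0 and right appends 1. *)
Definition pos w : nat := foldl (fun p (b : bool) => (2 * p + b)%N) 1%N w.

Lemma pos_rcons w b : pos (rcons w b) = (2 * pos w + b)%N.
Proof. by rewrite /pos foldl_rcons. Qed.

Lemma pos_gt0 w : (0 < pos w)%N.
Proof. elim/last_ind: w => // w b IH; rewrite pos_rcons; lia. Qed.

Lemma pos_inj : injective pos.
Proof.
elim/last_ind => [|w b IH] v; case/lastP: v => [|v c] //; rewrite ?pos_rcons.
- have := pos_gt0 v; rewrite /pos /=; lia.
- have := pos_gt0 w; rewrite [pos [::]]/pos /=; lia.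
move=> e; have bc : b = c by case: b c e => [] [] //; lia.
by rewrite bc in e *; rewrite (IH v) //; lia.
Qed.

Lemma pos_relevant w : (pos w = 1%N \/ ~~ odd (pos w)) <-> ~~ last false w.
Proof.
case/lastP: w => [|w b]; first by split=> // _; left.
rewrite last_rcons pos_rcons oddD mul2n odd_double oddb.
split=> [[|]|] //; last by right.
by have := pos_gt0 w; lia.
Qed.

Fixpoint walk w J t : option (nat * ideal k n * mvtree n) :=
  match w, t with
  | [::], _ => Some (0%N, J, t)
  | true :: w', MVNode m _ r => walk w' (mv_right J m) r
  | false :: w', MVNode m l _ =>
      omap (fun e => (e.1.1.+1, e.1.2, e.2)) (walk w' (mv_left J m) l)
  | _, MVLeaf => None
  end.

Lemma walk_rcons w b J t :
  walk (rcons w b) J t =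
  obind (fun e => omap (fun e' => ((e.1.1 + e'.1.1)%N, e'.1.2, e'.2))
                       (walk [:: b] e.1.2 e.2)) (walk w J t).
Proof.
elim: w J t => [|c w IH] J t /=.
  by case: b; case: t.
case: c; case: t => // m l r; rewrite IH //.
case: (walk w _ l) => //= -[[d K] s] /=.
by case: (b); case: s.
Qed.

Lemma mv_nodeP J t p d K s :
  mv_node J t p d K s <-> exists2 w, p = pos w & walk w J t = Some (d, K, s).
Proof.
split.
  elim=> [|p' d' J' m l r _ [w -> wE]|p' d' J' m l r _ [w -> wE]].
  - by exists [::].
  - exists (rcons w false); first by rewrite pos_rcons addn0.
    by rewrite walk_rcons wE /= addn1.
  - exists (rcons w true); first by rewrite pos_rcons.
    by rewrite walk_rcons wE /= addn0.
move=> [w -> {p}]; elim/last_ind: w d K s => [|w b IH] d K s.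
  by case=> <- <- <-; apply: mv_node_root.
rewrite walk_rcons pos_rcons; case: (walk w J t) IH => //= -[[d' K'] s'] IH.
case: b; case: s' IH => //= m l r IH [<- <- <-].
  by rewrite addn0; apply: mv_node_right; apply: IH.
by rewrite addn1 addn0; apply: mv_node_left; apply: IH.
Qed.

Lemma relevant_nodeP J t p d K :
  relevant_node J t p d K <->
  exists w s, [/\ p = pos w, ~~ last false w & walk w J t = Some (d, K, s)].
Proof.
split=> [[rp [s /mv_nodeP [w e ws]]]|[w [s [-> rw ws]]]].
  by exists w, s; split=> //; apply/pos_relevant; rewrite -e.
by split; [apply/pos_relevant|exists s; apply/mv_nodeP; exists w].
Qed.

End TreePaths.

(** * A Mayer-Vietoris tree and its relevant generators *)

Section Tree.

Variables (k : fieldType) (n : nat).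
Implicit Types (J K : ideal k n) (x y a c : 'X_{1..n}) (s : seq 'X_{1..n}).
Implicit Types (w : seq bool).

(** The pivot is the first generator of each node; [f] is fuel, for which the
    number of generators suffices. *)
Fixpoint mv_tree (f : nat) s : mvtree n :=
  match f, s with
  | f'.+1, x :: ((_ :: _) as s') =>
      MVNode x (mv_tree f' (minimals [seq mlcm x y | y <- s'])) (mv_tree f' s')
  | _, _ => MVLeaf n
  end.

Definition occ_left (e : seq bool * (nat * 'X_{1..n})) :=
  (false :: e.1, shift_deg e.2).

Definition occ_right (e : seq bool * (nat * 'X_{1..n})) :=
  (if e.1 is [::] then [::] else true :: e.1, e.2).

(** The generators of the relevant nodes, each with the path of its node and
    the dimension. The root of the right subtree is not relevant, but its
    generators are generators of the parent, so its occurrences move there: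
    hence every node contributes one generator, its pivot or, at a leaf, its
    only generator. *)
Fixpoint mv_occ (f : nat) s : seq (seq bool * (nat * 'X_{1..n})) :=
  match f, s with
  | f'.+1, x :: s' =>
      ([::], (0%N, x)) :: map occ_right (mv_occ f' s') ++
      map occ_left (mv_occ f' (minimals [seq mlcm x y | y <- s']))
  | _, _ => [::]
  end.

Definition mv_degs f s : seq (nat * 'X_{1..n}) := map snd (mv_occ f s).

Lemma mv_degs_cons f x s :
  mv_degs f.+1 (x :: s) = (0%N, x) :: mv_degs f s ++
    [seq shift_deg e | e <- mv_degs f (minimals [seq mlcm x y | y <- s])].
Proof. by rewrite /mv_degs /= map_cat -!map_comp. Qed.

Lemma size_left x s f :
  (size s <= f)%N -> (size (minimals [seq mlcm x y | y <- s]) <= f)%N.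
Proof.
by move=> sf; apply: leq_trans (size_minimals _) _; rewrite size_map.
Qed.

Lemma euler_char_mv_below f s c : (size s <= f)%N ->
  euler_char (mv_degs f s) (fun a => (a <= c)%MM) = (divisor_in s c)%:R.
Proof.
elim: f s => [|f IH] [|x s] // sf; rewrite ?/euler_char ?big_nil //.
rewrite mv_degs_cons -/(euler_char _ _).
apply: euler_char_inclusion_exclusion; first exact: IH.
by rewrite -divisor_in_minimals; apply: IH; apply: size_left.
Qed.

(** Both sides are numerators of the Hilbert series of the ideal generated by
    s. *)
Lemma euler_char_mv f s a : (size s <= f)%N ->
  euler_char (mv_degs f s) (pred1 a) = euler_char (taylor_degs s) (pred1 a).
Proof.
move=> sf; apply: same_hilbert_euler_char => c.
by rewrite euler_char_mv_below ?euler_char_taylor_below.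
Qed.

(** The degrees along the tree obey the recursion of the Taylor degrees, except
    that redundant least common multiples are discarded in the left child, and
    discarding generators only loses Taylor degrees. In particular a multidegree
    carried by a single face occurs at most once in the tree. *)
Lemma count_mv_degs f s (P : pred (nat * 'X_{1..n})) : (size s <= f)%N ->
  (count P (mv_degs f s) <= count P (taylor_degs s))%N.
Proof.
elim: f s P => [|f IH] [|x s] P // sf.
rewrite mv_degs_cons taylor_degs_cons /= !count_cat !(count_map (@shift_deg n)).
rewrite leq_add2l; apply: leq_add; first exact: IH.
apply: leq_trans (IH _ _ (@size_left x s f sf)) _.
exact: count_taylor_degs_subseq (minimals_subseq _).
Qed.

Lemma antichain_cons x s : antichain (x :: s) -> antichain s.
Proof.
by move=> sa y z ys zs; apply: sa; rewrite inE ?ys ?zs orbT.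
Qed.

Lemma mv_tree_is_mvtree f J s :
  (size s <= f)%N -> uniq s -> antichain s -> s <> [::] -> mingens J s ->
  is_mvtree J (mv_tree f s).
Proof.
elim: f J s => [|f IH] J [|x [|y s]] //= sf us sa _ Js.
  by exists x => m; rewrite Js inE; split=> /eqP.
have us' : uniq (y :: s) by case/andP: us.
split.
- by apply/Js; rewrite inE eqxx.
- exists y; split; first by apply/Js; rewrite !inE eqxx orbT.
  by move=> e; move: us; rewrite /= e inE eqxx.
- apply: IH; last exact: (mingens_left Js us).
  + exact: (@size_left x (y :: s)).
  + exact: minimals_uniq.
  + exact: minimals_antichain.
  move=> e; have : mlcm x y \in [seq mlcm x z | z <- y :: s].
    by rewrite inE eqxx.
  by case/minimals_below => z; rewrite e.
- by apply: IH => //; [apply: antichain_cons sa|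
     apply: mingens_right => //; apply: antichain_cons sa].
Qed.

Lemma mv_occ_root f s d a : ([::], (d, a)) \in mv_occ f s -> d = 0%N /\ a \in s.
Proof.
elim: f s d a => [|f IH] [|x s] //= d a.
rewrite inE mem_cat => /or3P [/eqP [-> ->]|/mapP|/mapP [] //].
  by rewrite mem_head.
by case=> -[[|b w] [d' a']] //= /IH [-> as'] [-> ->]; rewrite inE as' orbT.
Qed.

Lemma mv_occ_uniq f s : uniq s -> uniq (mv_occ f s).
Proof.
elim: f s => [|f IH] [|x s] //= /andP [xs us].
rewrite mem_cat negb_or -!andbA; apply/and3P; split.
- apply/negP => /mapP [[[|b w] [d a]]] //= /mv_occ_root [_ as_] [_ e].
  by rewrite e as_ in xs.
- by apply/negP => /mapP [].
rewrite cat_uniq !map_inj_uniq ?IH ?minimals_uniq //=; first last.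
- by move=> [[|b w] e] [[|b' w'] e'] //= [] // -> -> ->.
- by move=> [w [d a]] [w' [d' a']] /= [-> -> ->].
rewrite andbT; apply/hasPn => _ /mapP [e _ ->]; apply/negP => /mapP [].
by case=> [[|b w] e'].
Qed.

Lemma mv_occP f J s w d a :
  (size s <= f)%N -> uniq s -> antichain s -> mingens J s ->
  (w, (d, a)) \in mv_occ f s <->
  ~~ last false w /\ exists K t,
     walk w J (mv_tree f s) = Some (d, K, t) /\ mingen K a.
Proof.
have nil_case f' J' w' d' a' : mingens J' [::] ->
    ~ exists K t, walk w' J' (mv_tree f' [::]) = Some (d', K, t) /\ mingen K a'.
  move=> J0 [K [t []]]; case: f' => [|f']; case: w' => [|[] w'] //= [_ <- _];
  by move/J0.
elim: f J s w d a => [|f IH] J [|x s] w d a // sf us sa Js.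
- by split=> // -[_ /(nil_case 0%N) ].
- by split=> // -[_ /(nil_case f.+1) ].
have [xs us'] := andP us.
have sa' := antichain_cons sa.
have IHr v := IH (mv_right J x) s v _ _ sf us' sa' (mingens_right Js us sa').
have IHl v := IH (mv_left J x) _ v _ _ (@size_left x s f sf) (minimals_uniq _)
  (@minimals_antichain _ _) (mingens_left Js us).
rewrite [mv_occ _ _]/= inE mem_cat; case: w => [|b w].
  split=> [h|[_ [K [t [[<- <- _] /Js]]]]].
    split=> //; exists J, (mv_tree f.+1 (x :: s)).
    suff [-> as_] : d = 0%N /\ a \in x :: s by split=> //; apply/Js.
    apply: (@mv_occ_root f.+1); rewrite /= inE mem_cat; exact: h.
  rewrite inE => /orP [/eqP ->|as_]; first by rewrite eqxx.
  apply/or3P/Or32/mapP; exists ([::], (0%N, a)) => //.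
  apply/IHr; split=> //; exists (mv_right J x), (mv_tree f s); split=> //.
  exact/(mingens_right Js us sa').
have -> : mv_tree f.+1 (x :: s) = if s is [::] then MVLeaf n else
    MVNode x (mv_tree f (minimals [seq mlcm x y | y <- s])) (mv_tree f s).
  by case: (s).
case: b.
  have -> : ((true :: w, (d, a)) \in map occ_left
      (mv_occ f (minimals [seq mlcm x y | y <- s]))) = false.
    by apply/negP => /mapP [].
  rewrite orbF /=; split=> [/mapP [[[|b v] [d' a']] //= vo [-> -> ->]]|].
    have [rv [K [t [wE Ka]]]] := (IHr _ _ _).1 vo.
    split=> //; exists K, t; split=> //; move: wE.
    by case: (s) => //; case: (f) b {vo rv} => [|?] [].
  move=> [rw [K [t [wE Ka]]]]; apply/mapP.
  case: w rw wE => [|b w] //= rw wE; exists (b :: w, (d, a)) => //.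
  apply/IHr; split=> //; exists K, t; split=> //; move: wE.
  by case: (s).
have -> : ((false :: w, (d, a)) \in map occ_right (mv_occ f s)) = false.
  by apply/negP => /mapP [[[|b v] e]].
rewrite /=; split=> [/mapP [[v [d' a']] //= vo [-> -> ->]]|].
  have [rv [K [t [wE Ka]]]] := (IHl _ _ _).1 vo.
  split=> //; exists K, t; split=> //; case: (s) wE vo => [|y s'] wE vo.
    by case: (f) vo.
  by rewrite wE.
move=> [rw [K [t []]]]; case E : (s) => [|y s'] // wE Ka.
rewrite -E in wE *; apply/mapP.
case W : (walk w _ _) wE => [[[d' K'] t']|] //= [<- e1 e2].
exists (w, (d', a)) => //; apply/IHl; split=> //.
by exists K', t'; rewrite W e1; split.
Qed.

(** Distinct paths have distinct positions, and a path determines the node and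
    its dimension, so an unrepeated multidegree is one with a single entry. *)
Lemma mv_unrepeatedP f J s i a :
  (size s <= f)%N -> uniq s -> antichain s -> mingens J s ->
  mv_unrepeated J (mv_tree f s) i a <->
  (i, a) \in mv_degs f s /\ count (fun e => e.2 == a) (mv_degs f s) = 1%N.
Proof.
move=> sf us sa Js.
pose F := [seq e <- mv_occ f s | e.2.2 == a].
have FE : count (fun e => e.2 == a) (mv_degs f s) = size F.
  by rewrite /mv_degs count_map size_filter.
have FP w d b : (w, (d, b)) \in F <->
    b = a /\ exists2 K, relevant_node J (mv_tree f s) (pos w) d K & mingen K a.
  rewrite mem_filter /=; split=> [/andP [/eqP -> /(mv_occP _ _ _ sf us sa Js)]|].
    move=> [rw [K [t [wE Ka]]]]; split=> //; exists K => //.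
    by apply/relevant_nodeP; exists w, t.
  move=> [-> [K /relevant_nodeP [v [t [/pos_inj <- rw wE]]] Ka]].
  by rewrite eqxx; apply/(mv_occP _ _ _ sf us sa Js); split=> //; exists K, t.
have Fu : uniq F by rewrite filter_uniq ?mv_occ_uniq.
rewrite FE; split.
  move=> [p [K [rp Ka hp]]].
  have [w [t [pE rw wE]]] := (relevant_nodeP _ _ _ _ _).1 rp.
  have wF : (w, (i, a)) \in F by apply/FP; split=> //; exists K; rewrite -?pE.
  split; first by apply/mapP; exists (w, (i, a)) => //;
    move: wF; rewrite mem_filter => /andP [].
  have Fsub : {subset F <= [:: (w, (i, a))]}.
    move=> [w' [d' a']] /FP [-> [K' rK' K'a]]; rewrite inE.
    have /pos_inj e : pos w' = pos w by rewrite (hp _ _ _ rK' K'a).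
    move: rK'; rewrite e => /relevant_nodeP [w2 [t2 [/pos_inj <- _]]].
    by rewrite wE => -[<- _ _].
  apply/eqP; rewrite eqn_leq; apply/andP; split.
    exact: (uniq_leq_size Fu Fsub).
  by case: (F) wF.
move=> [/mapP [[w e] wO /= ie] sF].
have wF : (w, (i, a)) \in F by rewrite mem_filter /= eqxx ie.
have Fs e' : e' \in F -> e' = (w, (i, a)).
  case: (F) sF wF => [|e1 [|? ?]] //= _; rewrite !inE => /eqP -> /eqP ->//.
have [_ [K rK Ka]] := (FP _ _ _).1 wF.
exists (pos w), K; split=> // p' d' J' rJ' J'a.
have [w' [t' [pE rw wE]]] := (relevant_nodeP _ _ _ _ _).1 rJ'.
have : (w', (d', a)) \in F by apply/FP; split=> //; exists J'; rewrite -?pE.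
by rewrite pE => /Fs [->].
Qed.

Lemma betabar_mv_tree f J s i a :
  (size s <= f)%N -> uniq s -> antichain s -> mingens J s ->
  betabar J (mv_tree f s) i a =
  ((i, a) \in mv_degs f s) && (count (fun e => e.2 == a) (mv_degs f s) == 1%N).
Proof.
move=> sf us sa Js; have rep := mv_unrepeatedP i a sf us sa Js.
rewrite /betabar; case: ClassicalEpsilon.excluded_middle_informative.
  by move=> h /=; have [-> ->] := rep.1 h.
by move=> nrep /=; case: andP => // -[ia /eqP c1]; case: nrep; apply/rep.
Qed.

End Tree.

(** * The Taylor resolution *)

Section MonomialQuotients.

Variable n : nat.
Implicit Types a b c u : 'X_{1..n}.

Lemma subm_trans a b c :
  (a <= b)%MM -> (b <= c)%MM -> (c - b + (b - a) = c - a)%MM.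
Proof.
move=> /mnm_lepP ab /mnm_lepP bc; apply/mnmP => l.
by rewrite mnmDE !mnmBE; have := ab l; have := bc l; lia.
Qed.

Lemma lepm_subm_add a b c u :
  (a <= b)%MM -> (a <= c)%MM -> (c - a = u + (b - a))%MM -> (b <= c)%MM.
Proof.
move=> /mnm_lepP ab /mnm_lepP ac /mnmP e; apply/mnm_lepP => l.
by have := e l; rewrite mnmDE !mnmBE; have := ab l; have := ac l; lia.
Qed.

Lemma addmBA a b u : (a <= b)%MM -> (u + b - a = u + (b - a))%MM.
Proof.
move=> /mnm_lepP ab; apply/mnmP => l.
by rewrite !(mnmDE, mnmBE); have := ab l; lia.
Qed.

Lemma subm_eq0 a b : (a <= b)%MM -> (b - a == 0)%MM = (b == a).
Proof.
move=> ab; apply/eqP/eqP => [e|->]; first by rewrite -(submK ab) e add0m.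
by apply/mnmP => l; rewrite mnmBE mnm0E subnn.
Qed.

End MonomialQuotients.

Section Signs.

Variables (k : fieldType) (r : nat).
Implicit Types (i j : 'I_r) (sigma tau rho : {set 'I_r}).

(** The incidence sign between the simplex [j |: tau] and its face opposite j. *)
Definition esgn j tau : k := (-1) ^+ #|[set i in tau | (i < j)%N]|.

Lemma esgn_sqr j tau : esgn j tau * esgn j tau = 1.
Proof. by rewrite -expr2 sqrr_sign. Qed.

Lemma esgnU1 i j tau : i \notin tau ->
  esgn j (i |: tau) = (-1) ^+ (i < j)%N * esgn j tau.
Proof.
move=> it; rewrite /esgn -exprD; congr (_ ^+ _).
case: ltnP => ij /=.
  have -> : [set l in i |: tau | (l < j)%N] = i |: [set l in tau | (l < j)%N].
    by apply/setP => l; rewrite !inE; case: eqP => [->|] //=; rewrite ij.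
  by rewrite cardsU1 inE (negbTE it).
rewrite add0n; apply: eq_card => l; rewrite !inE; case: eqP => [->|] //=.
by rewrite ltnNge ij andbF.
Qed.

Lemma esgn_anticomm i j tau : i != j -> i \notin tau -> j \notin tau ->
  esgn i tau * esgn j (i |: tau) = - (esgn j tau * esgn i (j |: tau)).
Proof.
move=> ij it jt; rewrite !esgnU1 // !mulrA ![esgn _ _ * (-1) ^+ _]mulrC.
rewrite -!mulrA [esgn j tau * _]mulrC -mulNr; congr (_ * _).
by case: ltngtP (ij) => [||/val_inj ->]; rewrite ?eqxx ?expr1 ?expr0 ?opprK.
Qed.

Definition boundary (c : {set 'I_r} -> k) tau : k :=
  \sum_(i | i \notin tau) esgn i tau * c (i |: tau).

Definition cone j (c : {set 'I_r} -> k) sigma : k :=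
  if j \in sigma then esgn j (sigma :\ j) * c (sigma :\ j) else 0.

(** A cone is acyclic. The identity is stated at a single face tau, so that it
    applies to subcomplexes in which the cycle condition holds only on some
    faces. *)
Lemma boundary_cone j (c : {set 'I_r} -> k) tau :
  (j \in tau -> boundary c (tau :\ j) = 0) -> boundary (cone j c) tau = c tau.
Proof.
case: (boolP (j \in tau)) => jt cyc; last first.
  rewrite /boundary (bigD1 j) //= /cone setU11 setU1K // mulrA esgn_sqr mul1r.
  rewrite big1 ?addr0 // => i /andP [it ij].
  by rewrite !inE eq_sym (negbTE ij) (negbTE jt) mulr0.
pose rho := tau :\ j; have jr : j \notin rho by rewrite !inE eqxx.
have tE : tau = j |: rho by rewrite setD1K.
move: (cyc isT); rewrite /boundary (bigD1 j) //= -/rho -tE => /eqP.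
rewrite addr_eq0 => /eqP h; rewrite -[RHS]mul1r -(esgn_sqr j rho) -mulrA h mulrN.
rewrite mulr_sumr -sumrN; apply: eq_big => [i|i it].
  by rewrite tE !inE negb_or andbC.
have ij : i != j by apply: contraNneq it => ->.
have ir : i \notin rho by rewrite !inE negb_and it orbT.
rewrite /cone tE !inE eqxx orbT.
have -> : (i |: (j |: rho)) :\ j = i |: rho.
  by rewrite setUCA setU1K // in_setU1 negb_or jr andbT eq_sym.
rewrite !mulrA -mulNr; congr (_ * _).
have -> : esgn i (j |: rho) = - (esgn j rho * esgn i rho * esgn j (i |: rho)).
  by rewrite -mulrA esgn_anticomm // mulrN opprK mulrA esgn_sqr mul1r.
by rewrite mulNr -!mulrA esgn_sqr mulr1.
Qed.

End Signs.

Section Taylor.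

Variables (k : fieldType) (n r : nat) (g : 'I_r -> 'X_{1..n}).
Implicit Types (sigma tau rho : {set 'I_r}) (i j : 'I_r).
Implicit Types (a b u : 'X_{1..n}).

Local Notation R := {mpoly k[n]}.
Local Notation chain := ({set 'I_r} -> R).
Implicit Types (W : chain).

Definition lcms sigma : 'X_{1..n} :=
  [multinom (\max_(i in sigma) g i l)%N | l < n].

Lemma lcms_le sigma b : (lcms sigma <= b)%MM = [forall i in sigma, (g i <= b)%MM].
Proof.
apply/mnm_lepP/forall_inP => [h i si|h l].
  apply/mnm_lepP => l; apply: leq_trans (h l); rewrite mnmE.
  exact: (leq_bigmax_cond _ si).
by rewrite mnmE; apply/bigmax_leqP => i /h /mnm_lepP.
Qed.

Lemma lcms_leU1 i sigma b :
  (lcms (i |: sigma) <= b)%MM = (g i <= b)%MM && (lcms sigma <= b)%MM.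
Proof.
rewrite !lcms_le; apply/forall_inP/andP => [h|[h1 /forall_inP h2] j].
  split; first by apply: h; rewrite setU11.
  by apply/forall_inP => j js; apply: h; rewrite inE js orbT.
by rewrite !inE => /orP [/eqP->//|/h2].
Qed.

Lemma lcmsU1 i sigma : lcms (i |: sigma) = mlcm (g i) (lcms sigma).
Proof.
apply: lepm_anti.
  by rewrite lcms_leU1 lem_mlcml lem_mlcmr.
by rewrite lem_mlcm -lcms_leU1 lepm_refl.
Qed.

Lemma lcms0 : lcms set0 = 0%MM.
Proof. by apply/mnmP => l; rewrite mnmE mnm0E big_set0. Qed.

Lemma lcms1 i : lcms [set i] = g i.
Proof. by apply/mnmP => l; rewrite mnmE big_set1. Qed.

Lemma lcms_subset sigma tau : sigma \subset tau -> (lcms sigma <= lcms tau)%MM.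
Proof.
move=> st; have := lepm_refl (lcms tau); rewrite !lcms_le.
by move=> /forall_inP h; apply/forall_inP => i /(subsetP st); apply: h.
Qed.

Lemma lcms_leU1r i sigma : (lcms sigma <= lcms (i |: sigma))%MM.
Proof. exact/lcms_subset/subsetUr. Qed.

(** The Taylor complex on all faces, including the empty one: there it is the
    augmentation to R. *)
Definition taylor_bd W tau : R :=
  \sum_(i | i \notin tau)
    esgn k i tau *: (W (i |: tau) * 'X_[lcms (i |: tau) - lcms tau]).

(** The matrix entry of [taylor_bd]; the sum has at most one term, since i is
    determined by sigma and tau. *)
Definition taylor_coef sigma tau : R :=
  \sum_(i | (i \notin tau) && (sigma == i |: tau))
    esgn k i tau *: 'X_[lcms sigma - lcms tau].

Lemma taylor_bdE W tau :
  taylor_bd W tau = \sum_sigma W sigma * taylor_coef sigma tau.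
Proof.
rewrite /taylor_bd /taylor_coef.
under [RHS]eq_bigr => sigma _ do rewrite mulr_sumr.
rewrite (exchange_big_dep (fun i => i \notin tau)) /=; last by move=> s i _ /andP [].
apply: eq_bigr => i it; rewrite it (big_pred1 (i |: tau)).
  by rewrite scalerAr.
by move=> s; rewrite /= eq_sym.
Qed.

Lemma taylor_bd_bd W tau : taylor_bd (taylor_bd W) tau = 0.
Proof.
(* Removing i and j from a face in the two possible orders gives opposite
   terms; the double sum is split according to the order of i and j. *)
pose F i j : R := (esgn k i tau * esgn k j (i |: tau)) *:
  (W (j |: (i |: tau)) * 'X_[lcms (j |: (i |: tau)) - lcms tau]).
have -> : taylor_bd (taylor_bd W) tau =
    \sum_i \sum_j if [&& i \notin tau, j \notin tau & i != j] then F i j else 0.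
  rewrite {1}/taylor_bd big_mkcond; apply: eq_bigr => i _.
  case: ifP => it; last by rewrite big1.
  rewrite /taylor_bd mulr_suml scaler_sumr big_mkcond; apply: eq_bigr => j _ /=.
  rewrite !inE negb_or andbC eq_sym; case: ifP => // _.
  rewrite -scalerAl scalerA -mulrA -mpolyXD /F; congr (_ *: (_ * 'X_[_])).
  by rewrite subm_trans ?lcms_leU1r.
have FN i j : [&& i \notin tau, j \notin tau & i != j] -> F i j = - F j i.
  case/and3P => it jt ij; rewrite /F esgn_anticomm // scaleNr.
  by rewrite setUCA.
have -> : \sum_i \sum_j (if [&& i \notin tau, j \notin tau & i != j] then F i j
    else 0) = \sum_i \sum_j (if [&& i \notin tau, j \notin tau & (i < j)%N]
    then F i j else 0) + \sum_i \sum_j (if [&& i \notin tau, j \notin tau &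
    (j < i)%N] then F i j else 0).
  rewrite -big_split; apply: eq_bigr => i _; rewrite -big_split.
  apply: eq_bigr => j _ /=; case: (i \notin tau); case: (j \notin tau);
    rewrite /= ?addr0 //.
  by rewrite -val_eqE /=; case: ltngtP; rewrite ?addr0 ?add0r.
rewrite [X in _ + X]exchange_big -big_split big1 // => i _.
rewrite -big_split big1 // => j _ /=.
case: (boolP [&& i \notin tau, j \notin tau & (i < j)%N]).
  move=> /and3P [it jt ij]; rewrite it jt ij /= FN ?addNr //.
  by rewrite it jt -val_eqE neq_ltn ij.
by rewrite andbCA => /negbTE ->; rewrite addr0.
Qed.

(** The part of W of multidegree b, where e_sigma has multidegree
    lcm(sigma). *)
Definition degree_part W b sigma : k :=
  if (lcms sigma <= b)%MM then (W sigma)@_(b - lcms sigma) else 0.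

Lemma degree_part_bd W b tau :
  (lcms tau <= b)%MM ->
  degree_part (taylor_bd W) b tau = boundary (degree_part W b) tau.
Proof.
move=> tb; rewrite /degree_part tb /boundary /taylor_bd raddf_sum /=.
apply: eq_bigr => i it; rewrite mcoeffZ; congr (_ * _).
case: ifP => ib.
  by rewrite -(subm_trans (lcms_leU1r i tau) ib) addmC mcoeffMX.
apply/eqP; rewrite mcoeff_eq0 (perm_mem (msuppMX _ _)); apply/negP.
move=> /mapP [u _ e]; rewrite addmC in e.
by rewrite (lepm_subm_add (lcms_leU1r i tau) tb e) in ib.
Qed.

Lemma degree_part_eq W W' tau :
  (forall b, (lcms tau <= b)%MM -> degree_part W b tau = degree_part W' b tau) ->
  W tau = W' tau.
Proof.
move=> h; apply/mpolyP => u.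
have := h (u + lcms tau)%MM (lem_addl _ _).
by rewrite /degree_part lem_addl addmK.
Qed.

Lemma mpoly_of_coefs (d : nat) (f : 'X_{1..n} -> k) :
  (forall u, (d <= mdeg u)%N -> f u = 0) -> exists p : R, forall u, p@_u = f u.
Proof.
move=> fd; exists (\sum_(u : 'X_{1..n < d}) f u *: 'X_[u]) => u.
case: (ltnP (mdeg u) d) => ud; first exact: mcoeff_mpoly.
rewrite fd // raddf_sum big1 //= => v _; rewrite mcoeffZ mcoeffX.
case: eqP => [e|]; last by rewrite mulr0.
by move: ud; rewrite leqNgt -e bmdeg.
Qed.

(** In multidegree b the Taylor complex is the simplex on the generators
    dividing b, which is a cone over any one of them. The apex depends on b,
    so the contraction is assembled coefficient by coefficient; it is a
    polynomial because it does not raise the degrees of coefficients. *)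
Lemma taylor_exact W :
  (forall u, u \in msupp (W set0) -> exists i, (g i <= u)%MM) ->
  (forall tau, taylor_bd W tau = 0) ->
  exists W', forall tau, W tau = taylor_bd W' tau.
Proof.
move=> W0 cyc.
pose apex b := [pick i | (g i <= b)%MM].
pose C b sigma : k := if (lcms sigma <= b)%MM then
  (if apex b is Some j then cone j (degree_part W b) sigma else 0) else 0.
have /fin_all_exists [W' W'E] : forall sigma, exists p : R, forall u,
    p@_u = C (u + lcms sigma)%MM sigma.
  move=> sigma.
  apply: (@mpoly_of_coefs (\max_tau msize (W tau))%N) => u ud; rewrite /C.
  rewrite lem_addl; case: (apex _) => // j; rewrite /cone; case: ifP => // js.
  rewrite /degree_part; case: ifP => [le|]; last by rewrite mulr0.
  apply/eqP; rewrite mulf_eq0 mcoeff_eq0; apply/orP; right; apply: msize_mdeg_ge.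
  apply: leq_trans (leq_bigmax (F := fun s => msize (W s)) (sigma :\ j)) _.
  apply: leq_trans ud _.
  have sj : (lcms (sigma :\ j) <= lcms sigma)%MM by apply/lcms_subset/subD1set.
  rewrite (addmBA _ sj).
  by rewrite mdegD leq_addr.
have W'C b sigma : degree_part W' b sigma = C b sigma.
  rewrite /degree_part; case: ifP => sb; last by rewrite /C sb.
  by rewrite W'E submK.
exists W' => tau; apply: degree_part_eq => b tb; rewrite degree_part_bd //.
have bd0 rho : (lcms rho <= b)%MM -> boundary (degree_part W b) rho = 0.
  by move=> rb; rewrite -degree_part_bd // /degree_part rb cyc mcoeff0.
case E : (apex b) => [j|].
  have jb : (g j <= b)%MM by move: E; rewrite /apex; case: pickP => // ? ? [<-].
  rewrite -(@boundary_cone _ _ j) => [|jt]; last first.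
    by apply/bd0/(lepm_trans _ tb)/lcms_subset/subD1set.
  apply: eq_bigr => i it; rewrite W'C /C E; case: ifP => // ib.
  rewrite /cone; case: ifP => // jit; rewrite /degree_part.
  rewrite ifN ?mulr0 //; apply/negP => h; move/negP: ib; apply.
  by rewrite -(setD1K jit) lcms_leU1 jb.
have noi i : (g i <= b)%MM = false by move: E; rewrite /apex; case: pickP.
(* No generator divides b, so only the empty face has a part in degree b, and
   it vanishes there because W set0 lies in the ideal. *)
have t0 : tau = set0.
  apply/eqP/set0Pn => -[i it]; move: tb; rewrite lcms_le => /forall_inP /(_ i it).
  by rewrite noi.
rewrite [RHS]big1 => [|i _]; last by rewrite W'C /C lcms_leU1 noi mulr0.
rewrite t0 /degree_part lcms0 subm0; case: ifP => // _; apply/eqP.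
by rewrite mcoeff_eq0; apply/negP => /W0 [i]; rewrite noi.
Qed.

(** ** The resolution as a sequence of matrices *)

Definition faces (i : nat) : {set {set 'I_r}} :=
  [set s : {set 'I_r} | #|s| == i.+1].

Definition face (i : nat) (u : 'I_#|faces i|) : {set 'I_r} := enum_val u.

Lemma card_face (i : nat) (u : 'I_#|faces i|) : #|face u| = i.+1.
Proof. by have := enum_valP u; rewrite inE => /eqP. Qed.

Lemma face_inj (i : nat) : injective (@face i).
Proof. exact: enum_val_inj. Qed.

Lemma face_onto (i : nat) sigma : #|sigma| = i.+1 ->
  exists u : 'I_#|faces i|, face u = sigma.
Proof.
move=> h; have si : sigma \in faces i by rewrite inE h.
by exists (enum_rank_in si sigma); rewrite /face enum_rankK_in.
Qed.

Definition taylor_mx (i : nat) : 'M[R]_(#|faces i.+1|, #|faces i|) :=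
  \matrix_(u, v) taylor_coef (face u) (face v).

Definition taylor_aug : 'cV[R]_#|faces 0| :=
  \col_u taylor_coef (face u) set0.

(** Extension by zero to the faces of other sizes. *)
Definition chain_of (V : nmodType) (i : nat) (w : 'rV[V]_#|faces i|) sigma : V :=
  \sum_(u | face u == sigma) w 0 u.

Lemma chain_of_face (V : nmodType) (i : nat) (w : 'rV[V]_#|faces i|) (u : 'I_#|faces i|) :
  chain_of w (face u) = w 0 u.
Proof.
by rewrite /chain_of (big_pred1 u) // => v /=; rewrite (inj_eq (@face_inj i)).
Qed.

Lemma chain_of_out (V : nmodType) (i : nat) (w : 'rV[V]_#|faces i|) sigma :
  #|sigma| != i.+1 -> chain_of w sigma = 0.
Proof.
by move=> h; rewrite /chain_of big_pred0 // => u; apply: contraNF h => /eqP <-;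
  rewrite card_face.
Qed.

Lemma taylor_coef_out sigma tau : #|sigma| != #|tau|.+1 -> taylor_coef sigma tau = 0.
Proof.
move=> h; rewrite /taylor_coef big_pred0 // => i; apply: contraNF h.
by case/andP => it /eqP ->; rewrite cardsU1 it.
Qed.

Lemma sum_faces (i : nat) tau W : #|tau| = i ->
  \sum_(u : 'I_#|faces i|) W (face u) * taylor_coef (face u) tau =
  taylor_bd W tau.
Proof.
move=> ti; rewrite taylor_bdE.
rewrite -(big_enum_val (A := mem (faces i)) (fun s => W s * taylor_coef s tau)) /=.
rewrite [RHS](bigID (mem (faces i))) /= [X in _ + X]big1 ?addr0 // => s.
by rewrite inE => si; rewrite taylor_coef_out ?mulr0 ?ti.
Qed.

Lemma taylor_mxE (i : nat) (w : 'rV[R]_#|faces i.+1|) v :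
  (w *m taylor_mx i) 0 v = taylor_bd (chain_of w) (face v).
Proof.
rewrite mxE -(sum_faces _ (card_face v)); apply: eq_bigr => u _.
by rewrite mxE chain_of_face.
Qed.

Lemma taylor_augE (w : 'rV[R]_#|faces 0|) :
  (w *m taylor_aug) 0 0 = taylor_bd (chain_of w) set0.
Proof.
rewrite mxE -(@sum_faces 0) ?cards0 //; apply: eq_bigr => u _.
by rewrite mxE chain_of_face.
Qed.

Lemma taylor_bd_out (i : nat) (w : 'rV[R]_#|faces i|) tau :
  #|tau| != i -> taylor_bd (chain_of w) tau = 0.
Proof.
move=> ti; rewrite /taylor_bd big1 // => j jt.
by rewrite chain_of_out ?mul0r ?scaler0 // cardsU1 jt eqSS.
Qed.

Lemma eq_taylor_bd W W' tau :
  (forall i, i \notin tau -> W (i |: tau) = W' (i |: tau)) ->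
  taylor_bd W tau = taylor_bd W' tau.
Proof. by move=> h; apply: eq_bigr => i it; rewrite h. Qed.

Lemma chain_of_restrict (i : nat) W tau : #|tau| = i ->
  taylor_bd (chain_of (\row_(u < #|faces i|) W (face u))) tau = taylor_bd W tau.
Proof.
move=> ti; apply: eq_taylor_bd => j jt.
have [|u <-] := @face_onto i (j |: tau); first by rewrite cardsU1 jt ti.
by rewrite chain_of_face mxE.
Qed.

(** After extension by zero, being a cycle at the faces of one size is being a
    cycle at all faces, so [taylor_exact] applies. *)
Lemma taylor_mx_im (i : nat) (w : 'rV[R]_#|faces i|) :
  (forall tau, taylor_bd (chain_of w) tau = 0) <->
  exists w', w = w' *m taylor_mx i.
Proof.
split=> [cyc|[w' ->] tau].
  have [u|W' W'E] := taylor_exact _ cyc.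
    by rewrite chain_of_out ?cards0 // msupp0.
  exists (\row_u W' (face u)); apply/rowP => v.
  by rewrite taylor_mxE chain_of_restrict ?card_face // -W'E chain_of_face.
case: (eqVneq #|tau| i) => ti; last exact: taylor_bd_out.
rewrite -[RHS](taylor_bd_bd (chain_of w') tau); apply: eq_taylor_bd => j jt.
have [|u <-] := @face_onto i (j |: tau); first by rewrite cardsU1 jt ti.
by rewrite chain_of_face taylor_mxE.
Qed.

Lemma taylor_coef_homog sigma tau u :
  u \in msupp (taylor_coef sigma tau) -> (u + lcms tau)%MM = lcms sigma.
Proof.
rewrite /taylor_coef => /msupp_sum_le /flattenP [t /mapP [i]].
rewrite mem_filter => /andP [/andP [it /eqP ->] _] -> /msuppZ_le.
by rewrite msuppX inE => /eqP ->; rewrite submK // lcms_leU1r.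
Qed.

Variable (I : ideal k n).
Hypothesis IP : forall p, I p <-> forall u, u \in msupp p -> exists i, (g i <= u)%MM.

Lemma taylor_aug_im p : I p <-> exists w : 'rV[R]_#|faces 0|, p = (w *m taylor_aug) 0 0.
Proof.
rewrite IP; split=> [pI|[w ->] u].
  (* p, placed on the empty face, is a cycle; a chain bounding it expresses p
     in terms of the generators. *)
  pose W sigma : R := if sigma == set0 then p else 0.
  have [u|tau|W' W'E] := @taylor_exact W.
  - by rewrite /W eqxx; apply: pI.
  - rewrite /taylor_bd big1 // => i it; rewrite /W ifN ?mul0r ?scaler0 //.
    by apply/set0Pn; exists i; rewrite setU11.
  exists (\row_u W' (face u)).
  by rewrite taylor_augE chain_of_restrict ?cards0 // -W'E /W eqxx.
rewrite taylor_augE /taylor_bd => /msupp_sum_le /flattenP [t /mapP [i _ ->]].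
move/msuppZ_le; rewrite (perm_mem (msuppMX _ _)) => /mapP [v _ ->].
by exists i; rewrite setU0 lcms1 lcms0 subm0 lem_addr.
Qed.

Lemma taylor_diff_homog (i : nat) (u : 'I_#|faces i.+1|) (v : 'I_#|faces i|) m :
  m \in msupp (taylor_mx i u v) -> (m + lcms (face v))%MM = lcms (face u).
Proof. by rewrite mxE; apply: taylor_coef_homog. Qed.

Lemma taylor_aug_homog (u : 'I_#|faces 0|) m :
  m \in msupp (taylor_aug u 0) -> m = lcms (face u).
Proof. by rewrite mxE => /taylor_coef_homog; rewrite lcms0 addm0. Qed.

Lemma taylor_aug_exact (w : 'rV[R]_#|faces 0|) :
  w *m taylor_aug = 0 <-> exists w', w = w' *m taylor_mx 0.
Proof.
rewrite -taylor_mx_im; split=> [w0 tau|cyc].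
  case: (eqVneq #|tau| 0%N) => [/cards0_eq ->|]; last exact: taylor_bd_out.
  by rewrite -taylor_augE w0 mxE.
by apply/matrixP => i j; rewrite !ord1 taylor_augE cyc mxE.
Qed.

Lemma taylor_mx_exact (i : nat) (w : 'rV[R]_#|faces i.+1|) :
  w *m taylor_mx i = 0 <-> exists w', w = w' *m taylor_mx i.+1.
Proof.
rewrite -taylor_mx_im; split=> [w0 tau|cyc].
  case: (eqVneq #|tau| i.+1) => [/face_onto [v <-]|]; last exact: taylor_bd_out.
  by rewrite -taylor_mxE w0 mxE.
by apply/rowP => v; rewrite taylor_mxE cyc mxE.
Qed.

Definition taylor_resolution : free_resolution I :=
  FreeResolution taylor_diff_homog taylor_aug_homog taylor_aug_im
    taylor_aug_exact taylor_mx_exact.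

End Taylor.

(** * Multigraded Betti numbers from the Taylor resolution *)

Section Tor.

Variables (k : fieldType) (n r : nat) (g : 'I_r -> 'X_{1..n}).
Variable I : ideal k n.
Hypothesis IP : forall p, I p <-> forall u, u \in msupp p -> exists i, (g i <= u)%MM.

Local Notation F := (taylor_resolution IP).
Local Notation lcms := (lcms g).
Implicit Types (sigma tau : {set 'I_r}) (a : 'X_{1..n}).

Lemma sub_diag_mxP (N : nat) (P : pred 'I_N) (v : 'rV[k]_N) :
  reflect (forall j, ~~ P j -> v 0 j = 0)
          (v <= diag_mx (\row_j (P j)%:R))%MS.
Proof.
apply: (iffP idP) => [/submxP [w ->] j /negbTE Pj|h].
  by rewrite mul_mx_diag !mxE Pj mulr0.
apply/submxP; exists v; apply/rowP => j; rewrite mul_mx_diag !mxE.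
by case: (boolP (P j)) => [_|/h ->]; rewrite ?mulr1 ?mul0r.
Qed.

Lemma fr_partP (i : nat) a (v : 'rV[k]_#|faces r i|) :
  reflect (forall sigma, lcms sigma != a -> chain_of v sigma = 0)
          (v <= fr_part F i a)%MS.
Proof.
apply: (iffP (sub_diag_mxP _ _)) => /= h => [sigma sa|u ua].
  case: (eqVneq #|sigma| i.+1) => [/face_onto [u e]|]; last exact: chain_of_out.
  by rewrite -e chain_of_face h // e.
by rewrite -chain_of_face h.
Qed.

(** Killing the variables leaves the part of the simplicial boundary between
    faces with the same label: Tor in degree a is the homology of the strand of
    faces labelled a. *)
Lemma fr_diffkE (i : nat) (v : 'rV[k]_#|faces r i.+1|) x :
  (v *m fr_diffk F i) 0 x = \sum_(j | j \notin face x) esgn k j (face x) *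
    (if lcms (j |: face x) == lcms (face x) then chain_of v (j |: face x) else 0).
Proof.
pose w : 'rV[{mpoly k[n]}]_#|faces r i.+1| := map_mx (@mpolyC n k) v.
have -> : v = map_mx (mcoeff 0%MM) w.
  by apply/rowP => j; rewrite !mxE mcoeffC eqxx mulr1.
rewrite -map_mxM mxE taylor_mxE /taylor_bd raddf_sum /=; apply: eq_bigr => j jx.
rewrite mcoeffZ; congr (_ * _).
have -> : chain_of w (j |: face x) = (chain_of v (j |: face x))%:MP.
  by rewrite /chain_of raddf_sum /=; apply: eq_bigr => u _; rewrite mxE.
have -> : map_mx (mcoeff 0%MM) w = v.
  by apply/rowP => u; rewrite !mxE mcoeffC eqxx mulr1.
rewrite mcoeffCM mcoeffX subm_eq0 ?lcms_leU1r //.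
by case: ifP; rewrite ?mulr1 ?mulr0.
Qed.

Lemma fr_tor_dim_out (i : nat) a :
  (forall sigma, #|sigma| = i.+1 -> lcms sigma != a) -> fr_tor_dim F i a = 0%N.
Proof.
move=> h; have part0 : fr_part F i a = 0.
  apply/matrixP => u v; rewrite !mxE /=.
  by rewrite (negbTE (h _ (card_face u))) mul0rn.
by rewrite /fr_tor_dim part0 capmx0 mxrank0.
Qed.

(** A face whose label is shared with no other face is a cycle and meets no
    boundary. *)
Lemma fr_tor_dim_unique sigma a : sigma != set0 -> lcms sigma = a ->
  (forall tau, tau != set0 -> lcms tau = a -> tau = sigma) ->
  forall i, fr_tor_dim F i a = (i == #|sigma|.-1).
Proof.
move=> s0 sa uni i; have sgt0 : (0 < #|sigma|)%N by rewrite card_gt0.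
case: eqP => [iE|ne]; last first.
  apply: fr_tor_dim_out => tau ti; apply/eqP => ta; apply: ne.
  by rewrite -(uni tau) ?ti // -card_gt0 ti.
have si : #|sigma| = i.+1 by rewrite iE prednK.
have [u0 u0E] := face_onto si.
have partE : fr_part F i a = delta_mx u0 u0.
  apply/matrixP => u v; rewrite !mxE /=; have [->|uu0] := eqVneq u u0.
    by rewrite u0E sa eqxx eq_sym; case: (v == u0).
  case: eqP => [ua|_]; last by rewrite mul0rn.
  case/eqP: uu0; apply: face_inj; rewrite u0E; apply: uni => //.
  by rewrite -card_gt0 card_face.
have cyc : (fr_part F i a <= fr_cycles F i)%MS.
  case: (i) => [|j] /=; first exact: submx1.
  apply/rV_subP => v /fr_partP va; apply/sub_kermxP/rowP => x.
  rewrite fr_diffkE mxE big1 // => l lx; case: eqP => [e|]; last by rewrite mulr0.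
  have [ea|/va ->] := eqVneq (lcms (l |: face x)) a; last by rewrite mulr0.
  have ls : l |: face x = sigma.
    by apply: uni => //; apply/set0Pn; exists l; rewrite setU11.
  have xs : face x = sigma by apply: uni; rewrite -?card_gt0 ?card_face -?e.
  by case/negP: lx; rewrite xs -ls setU11.
rewrite /fr_tor_dim (capmx_idPr cyc) partE mxrank_delta -partE.
suff -> : (fr_diffk F i :&: fr_part F i a)%MS = 0 by rewrite mxrank0.
apply/eqP; rewrite -submx0; apply/rV_subP => v.
rewrite sub_capmx => /andP [/submxP [w vE] /fr_partP va].
rewrite submx0; apply/eqP/rowP => x; rewrite mxE.
have [ea|/va] := eqVneq (lcms (face x)) a; last by rewrite chain_of_face.
have xs : face x = sigma by apply: uni; rewrite -?card_gt0 ?card_face.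
rewrite vE fr_diffkE big1 // => l lx; case: eqP => [e|]; last by rewrite mulr0.
have ls : l |: face x = sigma.
  by apply: uni; rewrite ?e //; apply/set0Pn; exists l; rewrite setU11.
by case/negP: lx; rewrite xs -ls setU11.
Qed.

(** The faces with label a are closed under adding and removing the generator
    that strictly divides a, so coning with it contracts this strand. *)
Lemma fr_tor_dim_strict m a : a != 0%MM -> strictly_divides (g m) a ->
  forall i, fr_tor_dim F i a = 0%N.
Proof.
move=> a0 ma i; apply/eqP; rewrite /fr_tor_dim subn_eq0; apply: mxrankS.
have toggle tau : (lcms (m |: tau) == a) = (lcms tau == a).
  by rewrite lcmsU1 strictly_divides_lcm.
have toggleD tau : m \in tau -> (lcms (tau :\ m) == a) = (lcms tau == a).
  by move=> mt; rewrite -toggle setD1K.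
rewrite sub_capmx capmxSr andbT; apply/rV_subP => v.
rewrite sub_capmx => /andP [vcyc /fr_partP va].
pose c := chain_of v.
have cone0 tau : lcms tau != a -> cone m c tau = 0.
  rewrite /cone; case: ifP => // mt ta.
  by rewrite /c va ?mulr0 // toggleD.
apply/submxP; exists (\row_(u < #|faces r i.+1|) cone m c (face u)).
apply/rowP => x; set tau := face x; rewrite fr_diffkE -/tau.
transitivity (\sum_(j | j \notin tau) esgn k j tau *
    (if lcms (j |: tau) == lcms tau then cone m c (j |: tau) else 0)); last first.
  apply: eq_bigr => j jt; congr (_ * _); case: ifP => // _.
  have [|u <-] := @face_onto r i.+1 (j |: tau); first by rewrite cardsU1 jt card_face.
  by rewrite chain_of_face mxE.
have [ta|ta] := eqVneq (lcms tau) a; last first.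
  rewrite -chain_of_face va // big1 // => j jt.
  case: eqP => [e|]; last by rewrite mulr0.
  by rewrite cone0 ?mulr0 // e.
rewrite -chain_of_face -/tau -/c -(@boundary_cone _ _ m) => [|mt].
  apply: eq_bigr => j jt; congr (_ * _); case: eqP => // e.
  by rewrite cone0 // -ta; apply/eqP.
have ra : lcms (tau :\ m) = a by apply/eqP; rewrite toggleD // ta.
have rcard : #|tau :\ m| = i.
  by have := card_face x; rewrite -/tau (cardsD1 m) mt => -[].
(* The cycle condition at the face without m is available because this face is
   nonempty: the empty face has label 0, not a. *)
case: (i) v vcyc va @c cone0 x @tau ta mt ra rcard
  => [|i'] v vcyc va c cone0 x tau ta mt ra rcard.
  by move/cards0_eq: rcard ra => ->; rewrite lcms0 => e; rewrite -e eqxx in a0.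
have [y yE] := face_onto rcard.
move/sub_kermxP: vcyc => /(congr1 (fun w : 'rV_ _ => w 0 y)).
rewrite fr_diffkE mxE yE => h; rewrite -[RHS]h; apply: eq_bigr => j _.
rewrite ra; case: eqP => // /eqP /va; rewrite -/c => ->.
by [].
Qed.

End Tor.

(** * Faces as subsets of the generators *)

Section Faces.

Variables (n r : nat) (g : 'I_r -> 'X_{1..n}).
Implicit Types (t : seq 'I_r) (sigma tau : {set 'I_r}) (a : 'X_{1..n}).

Local Notation lcms := (lcms g).

Fixpoint subsets t : seq {set 'I_r} :=
  if t is i :: t' then [set i] :: subsets t' ++ [seq i |: s | s <- subsets t']
  else [::].

Lemma mem_subsets t sigma : uniq t ->
  (sigma \in subsets t) = (sigma != set0) && (sigma \subset t).
Proof.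
elim: t sigma => [|i t IH] sigma /= => [_|/andP [it ut]].
  apply/esym/negP => /andP [/set0Pn [i si] /subsetP /(_ i si)].
  by rewrite in_nil.
rewrite inE mem_cat IH //; apply/or3P/andP => [[/eqP ->|/andP [-> st]|]|].
- split; first by apply/set0Pn; exists i; rewrite inE.
  by apply/subsetP => j; rewrite inE => /eqP ->; apply: mem_head.
- split=> //; apply/subsetP => j /(subsetP st) jt; rewrite inE.
  by apply/orP; right.
- move=> /mapP [tau]; rewrite IH // => /andP [_ tt] ->; split.
    by apply/set0Pn; exists i; rewrite setU11.
  apply/subsetP => j; rewrite !inE => /orP [->//|/(subsetP tt) jt].
  by apply/orP; right.
move=> [s0 st]; case: (boolP (i \in sigma)) => si; last first.
  apply: Or32; rewrite s0; apply/subsetP => j js; have := subsetP st j js.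
  by rewrite inE => /orP [/eqP e|//]; rewrite -e js in si.
case: (eqVneq (sigma :\ i) set0) => [e|ne].
  by apply: Or31; rewrite -(setD1K si) e setU0.
apply: Or33; apply/mapP; exists (sigma :\ i); last by rewrite setD1K.
rewrite IH // ne; apply/subsetP => j; rewrite !inE => /andP [ji js].
by have := subsetP st j js; rewrite inE (negbTE ji).
Qed.

Lemma subsets_uniq t : uniq t -> uniq (subsets t).
Proof.
elim: t => //= i t IH /andP [it ut].
have nosub sigma : sigma \in subsets t -> i \notin sigma.
  by rewrite mem_subsets // => /andP [_ /subsetP st]; apply: contra it => /st.
rewrite mem_cat negb_or cat_uniq IH //=; apply/and3P; split.
- apply/andP; split; first by apply/negP => /nosub; rewrite inE eqxx.
  apply/negP => /mapP [tau tt e]; have := nosub _ tt.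
  move: tt; rewrite mem_subsets // => /andP [/set0Pn [j jt] _].
  have : j \in [set i] by rewrite e inE jt orbT.
  by rewrite inE => /eqP <-; rewrite jt.
- by apply/hasPn => _ /mapP [tau _ ->]; apply/negP => /nosub; rewrite setU11.
rewrite map_inj_in_uniq ?IH // => s1 s2 /nosub h1 /nosub h2 e.
by rewrite -(setU1K h1) e setU1K.
Qed.

(** Identifies the recursively defined degrees with the labels of the faces that
    index the basis of the Taylor resolution. *)
Lemma taylor_degs_subsets t : uniq t ->
  taylor_degs (map g t) = [seq (#|s|.-1, lcms s) | s : {set 'I_r} <- subsets t].
Proof.
elim: t => //= i t IH /andP [it ut].
rewrite cards1 lcms1 map_cat IH // -!map_comp; congr (_ :: _ ++ _).
apply/eq_in_map => s; rewrite mem_subsets // => /andP [s0 st] /=.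
have si : i \notin s by apply: contra it => /(subsetP st).
by rewrite /shift_deg /= lcmsU1 cardsU1 si /= prednK // card_gt0.
Qed.

(** Either some generator strictly divides a, or a generator i of sigma outside
    tau attains the exponent of a at some variable, where a generator of tau
    attains it as well; genericity then provides the strict divisor. *)
Lemma generic_lcm_repeated (k : fieldType) (I : ideal k n) sigma tau a :
  injective g -> (forall m, mingen I m <-> exists i, m = g i) -> generic I ->
  sigma != tau -> sigma != set0 -> tau != set0 ->
  lcms sigma = a -> lcms tau = a ->
  a != 0%MM /\ exists m, strictly_divides (g m) a.
Proof.
move=> ginj Ig gen ne s0 t0 sa ta.
wlog /subsetPn [i si ti] : sigma tau ne s0 t0 sa ta / ~~ (sigma \subset tau).
  move=> W; move: (ne); rewrite eqEsubset negb_and => /orP [h|h].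
    exact: (W sigma tau).
  by apply: (W tau sigma); rewrite // eq_sym.
have le (s : {set 'I_r}) j : lcms s = a -> j \in s -> (g j <= a)%MM.
  by move=> <- js; have := lepm_refl (lcms s); rewrite {1}lcms_le => /forall_inP; apply.
have gi := le _ _ sa si.
have [j tj] := set0Pn _ t0.
have a_neq0 : a != 0%MM.
  apply: contraNneq ti => a0; suff -> : i = j by [].
  apply: ginj; apply/mnmP => l; have := mnm_lepP gi l.
  have := mnm_lepP (le _ _ ta tj) l; rewrite a0 mnm0E !leqn0.
  by move=> /eqP -> /eqP ->.
split=> //.
case: (pickP (fun l => (0 < a l)%N && ~~ (g i <= a - U_(l))%MM)) => [l|h]; last first.
  by exists i => l al; move: (h l); rewrite al => /negbFE.
case/andP => al nle.
have gil : g i l = a l.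
  apply/eqP; rewrite eqn_leq (mnm_lepP gi) /= leqNgt; apply: contra nle => lt.
  apply/mnm_lepP => l'; rewrite mnmBE mnm1E; case: eqP => [<-|_].
    by rewrite leq_subRL // add1n.
  by rewrite subn0; apply/mnm_lepP.
have [j' tj' aj'] : exists2 j', j' \in tau & g j' l = a l.
  have [|j' tj' e] := @eq_bigmax_cond _ (mem tau) (fun j => g j l).
    by rewrite card_gt0.
  by exists j' => //; rewrite -e -ta mnmE.
have ij : i <> j' by move=> e; rewrite e tj' in ti.
have [||||mk [/Ig [m ->] _ _ ms]] := gen (g i) (g j').
- by apply/Ig; exists i.
- by apply/Ig; exists j'.
- by move/ginj.
- by exists l; rewrite gil aj'.
exists m; apply: strictly_divides_trans ms _.
  apply: contraTneq al => e; move/(congr1 (fun z : 'X_{1..n} => z l)): e.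
  by rewrite /mlcm mnmE gil aj' maxnn mnm0E => ->.
by rewrite lem_mlcm gi (le _ _ ta tj').
Qed.

End Faces.

(** * Generic monomial ideals are of type B1 *)

Unset Implicit Arguments.

Theorem corollary4p1p12 (k : fieldType) (hk : [pchar k] =i pred0) (n : nat)
    (I : ideal k n) (hI : monomial_ideal I) (hgen : generic I) :
  mv_type_B1 I.
Proof.
have [s [us sa s0 Is IP]] := monomial_ideal_mingens hI.
pose r := size s; pose g (i : 'I_r) := tnth (in_tuple s) i.
have gs : map g (enum 'I_r) = s by rewrite map_tnth_enum.
have sg m : m \in s <-> exists i, m = g i.
  by split=> [/(tnthP (in_tuple s))|[i ->]]; last exact: mem_tnth.
have ginj : injective g by apply/tuple_uniqP.
have IPg p : I p <-> forall u, u \in msupp p -> exists i, (g i <= u)%MM.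
  rewrite IP; split=> h u /h; first by case/hasP => m /sg [i ->] iu; exists i.
  by move=> [i iu]; apply/hasP; exists (g i) => //; apply/sg; exists i.
exists (mv_tree r s); split.
  exact: (mv_tree_is_mvtree (leqnn r) us sa s0 Is).
move=> i a; exists (taylor_resolution IPg).
rewrite (betabar_mv_tree _ _ (leqnn r) us sa Is); set degs := mv_degs r s.
have le_taylor P : (count P degs <= count P (taylor_degs s))%N.
  exact: count_mv_degs (leqnn r).
have chi : euler_char degs (pred1 a) = euler_char (taylor_degs s) (pred1 a).
  exact: euler_char_mv (leqnn r).
have taylorE : taylor_degs s =
    [seq (#|t|.-1, lcms g t) | t : {set 'I_r} <- subsets (enum 'I_r)].
  by rewrite -taylor_degs_subsets ?enum_uniq // gs.
pose L := [seq t <- subsets (enum 'I_r) | lcms g t == a].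
have LE (t : {set 'I_r}) : t \in L <-> t != set0 /\ lcms g t = a.
  rewrite mem_filter mem_subsets ?enum_uniq //.
  have -> : t \subset enum 'I_r by apply/subsetP => j _; rewrite mem_enum.
  by rewrite andbT andbC; split=> [/andP [-> /eqP]|[-> ->]] //; rewrite eqxx.
have uL : uniq L by rewrite filter_uniq ?subsets_uniq ?enum_uniq.
have countL : count (fun e => e.2 == a) (taylor_degs s) = size L.
  by rewrite taylorE count_map size_filter.
have degsL d : (d, a) \in degs -> exists2 t, t \in L & d = #|t|.-1.
  move=> da; have : (d, a) \in taylor_degs s.
    rewrite -has_pred1 has_count; apply: leq_trans (le_taylor _).
    by rewrite -has_count has_pred1.
  rewrite taylorE => /mapP [t tS [-> at_]]; exists t => //.
  by rewrite mem_filter tS at_ eqxx.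
case E : L LE uL countL degsL => [|sigma [|tau L']] LE uL countL degsL.
- rewrite fr_tor_dim_out => [|t ti].
    by case: eqP (le_taylor (fun e => e.2 == a)); rewrite ?andbF // countL => ->.
  by apply/eqP => ta; have /LE : t != set0 /\ lcms g t = a by rewrite -card_gt0 ti.
- have [sigma0 sigmaa] := (LE sigma).1 (mem_head _ _).
  rewrite (fr_tor_dim_unique IPg sigma0 sigmaa) => [|t t0 ta]; last first.
    by have /LE := conj t0 ta; rewrite inE => /eqP.
  have c1 : count (fun e => e.2 == a) degs = 1%N.
    apply/eqP; rewrite eqn_leq; apply/andP; split.
      by apply: leq_trans (le_taylor _) _; rewrite countL.
    (* If a did not occur in the tree, its Euler characteristic would vanish,
       but a single face contributes a sign. *)
    rewrite lt0n; apply/eqP => c0.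
    by have := euler_char_count1 countL; rewrite -chi euler_char_count0 // eqxx.
  have dimE d : (d, a) \in degs -> d = #|sigma|.-1.
    by move=> /degsL [t]; rewrite inE => /eqP ->.
  rewrite c1 eqxx andbT; congr (nat_of_bool _); apply/eqP/idP => [->|/dimE //].
  have : has (fun e => e.2 == a) degs by rewrite has_count c1.
  by case/hasP => -[d b] dd /= /eqP ba; rewrite ba in dd; rewrite -(dimE d dd).
have [sigma0 sigmaa] := (LE sigma).1 (mem_head _ _).
have [tau0 taua] : tau != set0 /\ lcms g tau = a.
  by apply/LE; rewrite !inE eqxx orbT.
have st : sigma != tau by move: uL; rewrite /= inE negb_or -!andbA => /and3P [].
have Ig m : mingen I m <-> exists i, m = g i by rewrite (Is m).
have [a0 [m ma]] := generic_lcm_repeated ginj Ig hgen st sigma0 tau0 sigmaa taua.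
rewrite (fr_tor_dim_strict _ a0 ma).
(* The faces cancel in pairs, so the signed count over the tree is zero and a
   cannot occur exactly once. *)
case: eqP => [c1|]; rewrite ?andbF //.
have := euler_char_count1 c1; rewrite chi (euler_char_taylor_strict _ a0 ma) ?eqxx //.
by apply/sg; exists m.
Qed.
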